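(* Let $r\in\mathbb{N}$ and let $(Q',Q'')$ be a pair of positive definite (respectively, negative definite) quadrature formulae of order $r$. Assume that, for some $c>0$, the quadrature formula $$\widehat{Q}:=(c+1)\,Q'-c\,Q''$$ is negative definite (respectively, positive definite) of order $r$. Then the following inequalities hold whenever $f$ is an $r$-convex or $r$-concave function: (i) $|R[Q';f]|\le \frac{c}{c+1}\,|R[Q'';f]|$; (ii) $|R[Q';f]|\le c\,|Q'[f]-Q''[f]|$; (iii) $|R[Q'';f]|\le (c+1)\,|Q'[f]-Q''[f]|$.
   Context: A quadrature formula is a functional $Q[f]=\sum_{i=1}^{N}a_i f(\tau_i)$ with finitely many nodes $0\le\tau_1<\dots<\tau_N\le 1$ and real weights $a_i$, used to approximate $I[f]=\int_0^1 f(x)\,dx$; its remainder is $R[Q;f]=I[f]-Q[f]$. $Q$ is called definite of order $r$ if there is a real non-zero constant $c_r(Q)$ such that for every $f\in C^r[0,1]$ there is $\xi\in[0,1]$ (depending on $f$) with $R[Q;f]=c_r(Q)f^{(r)}(\xi)$; it is positive definite of order $r$ if $c_r(Q)>0$ and negative definite of order $r$ if $c_r(Q)<0$. A function $f$ is called $r$-convex (respectively $r$-concave) if $f\in C^r[0,1]$ and $f^{(r)}\ge 0$ (respectively $f^{(r)}\le 0$) on $[0,1]$. The two formulae $Q',Q''$ may have different nodes and different numbers of nodes. *)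

(* Defs.v *)
From Stdlib Require Import Reals Lra Lia.
From Coquelicot Require Import Coquelicot.

Open Scope R_scope.

(* Functions on [0,1] are represented by total functions R -> R. Every notion
   below depends only on the values on [0,1]: limits are taken relative to
   [0,1], so derivatives and continuity at 0 and 1 are one-sided. *)
Definition unit_interval (x : R) : Prop := 0 <= x <= 1.

Fixpoint is_nth_derivative (k : nat) (f g : R -> R) : Prop :=
  match k with
  | O => forall x, unit_interval x -> g x = f x
  | S k' => exists h : R -> R,
      is_nth_derivative k' f h /\
      forall x, unit_interval x -> D_in h g unit_interval x
  end.

(* f belongs to C^r[0,1] and its r-th derivative is g; g is determined by f
   on [0,1], so quantifying over such g amounts to writing f^(r). *)
Definition Cr_with_derivative (r : nat) (f g : R -> R) : Prop :=
  is_nth_derivative r f g /\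
  forall x, unit_interval x -> continue_in g unit_interval x.

Definition r_convex (r : nat) (f : R -> R) : Prop :=
  exists g, Cr_with_derivative r f g /\ forall x, unit_interval x -> 0 <= g x.

Definition r_concave (r : nat) (f : R -> R) : Prop :=
  exists g, Cr_with_derivative r f g /\ forall x, unit_interval x -> g x <= 0.

Definition quadrature_formula (Q : (R -> R) -> R) : Prop :=
  exists (N : nat) (tau a : nat -> R),
    (forall i, (1 <= i <= N)%nat -> 0 <= tau i <= 1) /\
    (forall i, (1 <= i < N)%nat -> tau i < tau (S i)) /\
    (forall f, Q f = sum_n_m (fun i => a i * f (tau i)) 1 N).

Definition remainder (Q : (R -> R) -> R) (f : R -> R) : R := RInt f 0 1 - Q f.

(* c is the constant c_r(Q); it is unique, as f(x) = x^r / r! shows. *)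
Definition definite_with_constant (r : nat) (Q : (R -> R) -> R) (c : R) : Prop :=
  c <> 0 /\
  forall f g, Cr_with_derivative r f g ->
    exists xi, unit_interval xi /\ remainder Q f = c * g xi.

Definition positive_definite (r : nat) (Q : (R -> R) -> R) : Prop :=
  exists c, definite_with_constant r Q c /\ 0 < c.

Definition negative_definite (r : nat) (Q : (R -> R) -> R) : Prop :=
  exists c, definite_with_constant r Q c /\ c < 0.

(* Main.v *)
Require Import Defs.
From Stdlib Require Import Reals Lra Lia.
From Coquelicot Require Import Coquelicot.
Open Scope R_scope.

(** The weights [c + 1] and [- c] add up to [1], so the remainder of
    [(c + 1) Q' - c Q''] at [f] is [(c + 1) R' - c R''], where [R'] and [R'']
    are the remainders of [Q'] and [Q''] at [f].  As [f^(r)] has constant sign,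
    definiteness gives [R'] and this combination weakly opposite signs.  Up to
    a global change of sign, [0 <= R'] and [(c + 1) R' <= c R''], so that
    [0 <= R' <= R''] because [c > 0].  The three inequalities then follow by
    linear arithmetic, since [Q' f - Q'' f = R'' - R']. *)

Lemma remainder_combination (c : R) (Q' Q'' : (R -> R) -> R) (f : R -> R) :
  remainder (fun f => (c + 1) * Q' f - c * Q'' f) f =
  (c + 1) * remainder Q' f - c * remainder Q'' f.
Proof. unfold remainder; ring. Qed.

Lemma definite_remainder_nonneg (r : nat) (Q : (R -> R) -> R) (k : R)
  (f g : R -> R) :
  definite_with_constant r Q k -> Cr_with_derivative r f g ->
  (forall x, unit_interval x -> 0 <= k * g x) -> 0 <= remainder Q f.
Proof.
  intros [_ HQ] Hfg Hsign.
  destruct (HQ f g Hfg) as [xi [Hxi ->]]; auto.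
Qed.

Lemma definite_remainder_nonpos (r : nat) (Q : (R -> R) -> R) (k : R)
  (f g : R -> R) :
  definite_with_constant r Q k -> Cr_with_derivative r f g ->
  (forall x, unit_interval x -> k * g x <= 0) -> remainder Q f <= 0.
Proof.
  intros [_ HQ] Hfg Hsign.
  destruct (HQ f g Hfg) as [xi [Hxi ->]]; auto.
Qed.

(** Here [a] and [b] stand for the remainders of [Q'] and [Q''], so that the
    difference of the two formulae is [b - a]. *)
Lemma remainder_bounds_nonneg (c a b : R) :
  0 < c -> 0 <= a -> (c + 1) * a - c * b <= 0 ->
  Rabs a <= c / (c + 1) * Rabs b /\
  Rabs a <= c * Rabs (b - a) /\
  Rabs b <= (c + 1) * Rabs (b - a).
Proof.
  intros Hc Ha Hab.
  assert (Hle : a <= b) by nra.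
  rewrite !Rabs_pos_eq by lra.
  repeat split; try lra.
  replace (c / (c + 1) * b) with (c * b / (c + 1)) by (field; lra).
  apply Rle_div_r; lra.
Qed.

Lemma remainder_bounds (c a b : R) :
  0 < c ->
  (0 <= a /\ (c + 1) * a - c * b <= 0) \/
  (a <= 0 /\ 0 <= (c + 1) * a - c * b) ->
  Rabs a <= c / (c + 1) * Rabs b /\
  Rabs a <= c * Rabs (b - a) /\
  Rabs b <= (c + 1) * Rabs (b - a).
Proof.
  intros Hc [[Ha Hab] | [Ha Hab]].
  - now apply remainder_bounds_nonneg.
  - rewrite <- (Rabs_Ropp a), <- (Rabs_Ropp b), <- (Rabs_Ropp (b - a)).
    replace (- (b - a)) with (- b - - a) by ring.
    apply remainder_bounds_nonneg; lra.
Qed.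

Theorem theorem1 (r : nat) (Q' Q'' : (R -> R) -> R) (c : R)
  (hQ' : quadrature_formula Q') (hQ'' : quadrature_formula Q'')
  (hc : 0 < c)
  (hdef :
     (positive_definite r Q' /\ positive_definite r Q'' /\
      negative_definite r (fun f => (c + 1) * Q' f - c * Q'' f)) \/
     (negative_definite r Q' /\ negative_definite r Q'' /\
      positive_definite r (fun f => (c + 1) * Q' f - c * Q'' f)))
  (f : R -> R) (hf : r_convex r f \/ r_concave r f) :
  Rabs (remainder Q' f) <= c / (c + 1) * Rabs (remainder Q'' f) /\
  Rabs (remainder Q' f) <= c * Rabs (Q' f - Q'' f) /\
  Rabs (remainder Q'' f) <= (c + 1) * Rabs (Q' f - Q'' f).
Proof.
  replace (Q' f - Q'' f) with (remainder Q'' f - remainder Q' f)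
    by (unfold remainder; ring).
  apply remainder_bounds; [exact hc |].
  rewrite <- remainder_combination.
  destruct hdef as [[[k' [H' ?]] [_ [k [H ?]]]] | [[k' [H' ?]] [_ [k [H ?]]]]];
    destruct hf as [[g [Hfg Hg]] | [g [Hfg Hg]]].
  (* The constants [k'] and [k] have opposite signs, so each of the four
     combinations with the sign of [g] falls under one alternative. *)
  - left; split;
      [apply (definite_remainder_nonneg r _ k' f g)
      |apply (definite_remainder_nonpos r _ k f g)];
      auto; intros x Hx; specialize (Hg x Hx); nra.
  - right; split;
      [apply (definite_remainder_nonpos r _ k' f g)
      |apply (definite_remainder_nonneg r _ k f g)];
      auto; intros x Hx; specialize (Hg x Hx); nra.
  - right; split;
      [apply (definite_remainder_nonpos r _ k' f g)
      |apply (definite_remainder_nonneg r _ k f g)];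
      auto; intros x Hx; specialize (Hg x Hx); nra.
  - left; split;
      [apply (definite_remainder_nonneg r _ k' f g)
      |apply (definite_remainder_nonpos r _ k f g)];
      auto; intros x Hx; specialize (Hg x Hx); nra.
Qed.
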